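(* For every tree $T$ of order $n$, $\operatorname{bdim}(T)\ge\sqrt{n/6}$.
   Context: $d(u,v)$ is graph distance and $d_k(u,v)=\min\{d(u,v),k+1\}$ for a positive integer $k$. A function $f:V(T)\to\mathbb{Z}_{\ge0}$ is a resolving broadcast of $T$ if for any distinct $x,y\in V(T)$ there is $z$ with $f(z)>0$ and $d_{f(z)}(x,z)\ne d_{f(z)}(y,z)$; $\operatorname{bdim}(T)$ is the minimum of $\sum_v f(v)$ over resolving broadcasts $f$ of $T$.
   Formalization: The tree is assumed to have order n at least 2, because for the one-vertex tree the zero function is vacuously a resolving broadcast, so bdim is 0, which is less than sqrt(1/6). *)

(* Defs.v *)
From mathcomp Require Import all_boot all_order all_algebra.
From mathcomp Require Import boolp reals.

Set Implicit Arguments.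
Unset Strict Implicit.
Unset Printing Implicit Defensive.

(* A graph is a relation [e] on its finite vertex type [T]. *)

Definition simple_graph (T : finType) (e : rel T) : Prop :=
  symmetric e /\ irreflexive e.

Definition connected_graph (T : finType) (e : rel T) : Prop :=
  0 < #|T| /\ forall x y : T, connect e x y.

(* In mathcomp, [:: x; y] is a [ucycle] as soon as xy is an edge, and an actual
   graph cycle is a [ucycle] with at least three vertices. *)
Definition acyclic_graph (T : finType) (e : rel T) : Prop :=
  forall c : seq T, ucycle e c -> size c <= 2.

Definition tree (T : finType) (e : rel T) : Prop :=
  [/\ simple_graph e, connected_graph e & acyclic_graph e].

Section Broadcast.

Variables (T : finType) (e : rel T).

Definition has_walk (x y : T) (k : nat) : bool :=
  [exists p : k.-tuple T, path e x p && (last x p == y)].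

(* Shortest walks repeat no vertex, hence have length less than #|T|; the value
   is #|T| when no walk joins x to y, which does not occur in a connected graph. *)
Definition dist (x y : T) : nat := find (has_walk x y) (iota 0 #|T|).

Definition dist_trunc (k : nat) (x y : T) : nat := minn (dist x y) k.+1.

Definition resolving_broadcast (f : {ffun T -> nat}) : Prop :=
  forall x y : T, x != y ->
    exists z : T, 0 < f z /\ dist_trunc (f z) x z <> dist_trunc (f z) y z.

Definition broadcast_cost (f : {ffun T -> nat}) : nat := \sum_v f v.

Definition resolving_cost (m : nat) : Prop :=
  exists f : {ffun T -> nat}, resolving_broadcast f /\ broadcast_cost f = m.

Lemma dist_eq0 (x y : T) : (dist x y == 0) = (x == y).
Proof.
have : 0 < #|T| by apply/card_gt0P; exists x.
rewrite /dist; case: #|T| => // k _ /=.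
have -> : has_walk x y 0 = (x == y).
  apply/existsP/idP => [[p]|xy]; first by rewrite tuple0.
  by exists [tuple].
by case: (x == y).
Qed.

Lemma resolving_cost_ex : exists m, `[< resolving_cost m >].
Proof.
pose f : {ffun T -> nat} := [ffun=> 1].
exists (broadcast_cost f); apply/asboolP; exists f; split=> // x y xy.
exists x; rewrite ffunE; split=> //.
have /eqP dxx : dist x x == 0 by rewrite dist_eq0.
have : dist y x != 0 by rewrite dist_eq0 eq_sym.
by rewrite /dist_trunc dxx; case: (dist y x) => // k _; rewrite minnSS.
Qed.

Definition bdim : nat := ex_minn resolving_cost_ex.

End Broadcast.

(* Main.v *)
(* Root the tree at r and let f be a resolving broadcast of cost b.  Call p a
   gate of v if p lies on the geodesic from v to every z whose ball, of radius
   f z, contains v.  A gate p and the distance h = d(v,p) determine v, because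
   they determine all truncated distances from v.  If v is covered, a gate
   farthest from v is an ancestor of some z covering v, hence is determined by z
   and a = d(z,p), where a and h are at most f z.  So at most
   sum_z (f z + 1)^2 <= 4 b^2 vertices are covered, the sum being over f z > 0;
   at most one vertex is not covered. *)

Require Import Defs.
From mathcomp Require Import all_boot all_order all_algebra.
From mathcomp Require Import boolp reals.
From mathcomp Require Import zify.

Import Order.TTheory GRing.Theory Num.Theory.
Local Open Scope ring_scope.

Set Implicit Arguments.
Unset Strict Implicit.

(** * Walks and the graph metric *)

Section Distance.
Local Open Scope nat_scope.

Variables (T : finType) (e : rel T).

Lemma has_walkP (x y : T) (k : nat) :
  reflect (exists p, [/\ path e x p, last x p = y & size p = k])
          (has_walk e x y k).
Proof.
apply: (iffP existsP) => [[p /andP[ep /eqP lp]]|[p [ep lp sp]]].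
  by exists p; rewrite size_tuple.
by move/eqP: sp => sp; exists (Tuple sp); rewrite ep lp eqxx.
Qed.

Lemma dist_le_walk (x y : T) (k : nat) : has_walk e x y k -> dist e x y <= k.
Proof.
move=> w; case: (ltnP k #|T|) => [kT|]; last first.
  by apply: leq_trans; rewrite -[leqRHS](size_iota 0) find_size.
rewrite leqNgt; apply/negP => lt_k.
by have := before_find 0 lt_k; rewrite nth_iota // add0n w.
Qed.

Hypotheses (e_sym : symmetric e) (e_conn : forall x y, connect e x y).

(** A walk without repeated vertices has length below [#|T|], so the search defining [dist]
    succeeds. *)
Lemma dist_walk (x y : T) : has_walk e x y (dist e x y).
Proof.
have hasw : has (has_walk e x y) (iota 0 #|T|).
  have /connectP[p ep ->] := e_conn x y.
  case/shortenP: ep => q eq uq _.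
  apply/hasP; exists (size q); last by apply/has_walkP; exists q.
  rewrite mem_iota /= add0n -[_ < _]/(size (x :: q) <= _).
  by rewrite -(card_uniqP uq) max_card.
have lt : dist e x y < #|T| by rewrite -[ltnRHS](size_iota 0) -has_find.
by have := nth_find 0 hasw; rewrite nth_iota.
Qed.

Lemma distxx (x : T) : dist e x x = 0.
Proof. by apply/eqP; rewrite dist_eq0. Qed.

Lemma dist_triangle (y x z : T) : dist e x z <= dist e x y + dist e y z.
Proof.
have /has_walkP[p [ep lp <-]] := dist_walk x y.
have /has_walkP[q [eq lq <-]] := dist_walk y z.
apply/dist_le_walk/has_walkP; exists (p ++ q).
by rewrite cat_path last_cat size_cat ep lp.
Qed.

Lemma dist_sym (x y : T) : dist e x y = dist e y x.
Proof.
wlog suff : x y / dist e x y <= dist e y x.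
  by move=> le; apply/eqP; rewrite eqn_leq !le.
have /has_walkP[p [ep lp <-]] := dist_walk y x.
apply/dist_le_walk/has_walkP; exists (rev (belast y p)).
split; last by rewrite size_rev size_belast.
  by rewrite -lp rev_path (eq_path (e' := e)) // => u v; rewrite e_sym.
case: p lp {ep} => [/= ->|z p _] //.
by rewrite -[belast y _]/(y :: belast z p) rev_cons last_rcons.
Qed.

Lemma dist_edge (x y z : T) : e x y -> dist e x z <= (dist e y z).+1.
Proof.
move=> exy; apply: leq_trans (dist_triangle y x z) _.
rewrite -add1n leq_add2r; apply/dist_le_walk/has_walkP.
by exists [:: y]; rewrite /= exy.
Qed.

Lemma dist_succ (x z : T) (n : nat) :
  dist e x z = n.+1 -> exists2 y, e x y & dist e y z = n.
Proof.
move=> dxz; have /has_walkP[[|y p] []] := dist_walk x z; rewrite dxz //=.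
move=> /andP[exy ep] lp [sp]; exists y => //.
have /dist_le_walk : has_walk e y z n by apply/has_walkP; exists p.
by have := dist_edge z exy; rewrite dxz; lia.
Qed.

End Distance.

(** * Parents and ancestors in a rooted tree *)

Section RootedTree.
Local Open Scope nat_scope.

Variables (T : finType) (e : rel T).
Hypotheses (e_sym : symmetric e) (e_conn : forall x y, connect e x y).
Hypothesis e_acyclic : acyclic_graph e.
Variable r : T.

(** A duplicate-free [e']-path from x to y has an inner vertex, so the edge xy would close it to a
    cycle on at least three vertices. *)
Lemma edge_bridge (x y : T) (e' : rel T) :
  e x y -> subrel e' e -> ~~ e' x y -> x != y -> ~~ connect e' x y.
Proof.
move=> exy sub ne'xy nexy; apply/negP => /connectP[p ep ly].
case/shortenP: ep ly => q eq uq _ ly.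
have : ucycle e (x :: q).
  by rewrite /ucycle uq andbT /= rcons_path (sub_path sub eq) -ly e_sym.
move/e_acyclic; case: q eq uq ly => [|a [|b q]] //=.
  by move=> _ _ yx; rewrite yx eqxx in nexy.
by move=> /andP[e'xa _] _ ya; rewrite ya e'xa in ne'xy.
Qed.

(** The default value makes the root its own parent. *)
Definition parent (x : T) : T :=
  odflt x [pick y | e x y & dist e x r == (dist e y r).+1].

Lemma parentP (x : T) :
  x != r -> e x (parent x) /\ dist e x r = (dist e (parent x) r).+1.
Proof.
move=> nexr; rewrite /parent; case: pickP => [y /andP[exy /eqP]|no] //=.
case dxr : (dist e x r) => [|n].
  by move/eqP: dxr; rewrite dist_eq0 (negPf nexr).
have [y exy dyr] := dist_succ e_conn dxr.
by have := no y; rewrite exy dxr dyr eqxx.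
Qed.

(* If neither endpoint were the parent of the other, both would remain
   connected to the root through parents after deleting the edge. *)
Lemma edge_parent (x y : T) :
  e x y -> x != y -> y = parent x \/ x = parent y.
Proof.
move=> exy nexy; case: (eqVneq y (parent x)) => [|npx]; first by left.
case: (eqVneq x (parent y)) => [|npy]; first by right.
pose e' : rel T := [rel u v | [&& e u v, (u, v) != (x, y) & (u, v) != (y, x)]].
have e'_sym : connect_sym e'.
  apply: sym_connect_sym => u v; rewrite /e' /= e_sym !xpair_eqE.
  by congr (_ && _); rewrite andbC (andbC (u == x)) (andbC (u == y)).
have to_root u : connect e' u r.
  move: {2}(dist e u r) (erefl (dist e u r)) => n.
  elim: n u => [|n IH] u dur.
    by move/eqP: dur; rewrite dist_eq0 => /eqP->; apply: connect0.
  have neur : u != r by rewrite -(dist_eq0 e) dur.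
  have [eu] := parentP neur; rewrite dur => -[/esym /IH].
  apply: connect_trans; apply: connect1; rewrite /e' /= eu !xpair_eqE /=.
  rewrite !negb_and; apply/andP; split; case: (eqVneq u) => //= ->.
    by rewrite eq_sym.
  by rewrite eq_sym.
have : ~~ e' x y by rewrite /e' /= eqxx andbF.
have sub : subrel e' e by move=> u v /and3P[].
move/(edge_bridge exy sub) => /(_ nexy).
by rewrite (connect_trans (to_root x)) // e'_sym.
Qed.

Lemma parent_root : parent r = r.
Proof. by rewrite /parent; case: pickP => // y; rewrite distxx andbF. Qed.

(** Let c be the first step from p towards z. If c is not the parent of p, then p is the parent of
    c. Going from c to z through p would be a detour, so by induction c is an ancestor of z, and so
    is p. *)
Lemma ancestor_or_up (p z : T) :
  dist e z r = dist e z p + dist e p r \/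
  dist e p z = (dist e (parent p) z).+1.
Proof.
move: {2}(dist e p z) (erefl (dist e p z)) => n.
elim: n p => [|n IH] p dpz.
  by move/eqP: dpz; rewrite dist_eq0 => /eqP->; left; rewrite distxx.
have [c epc dcz] := dist_succ e_conn dpz.
have nepc : p != c by apply/eqP => pc; move: dpz; rewrite pc dcz; lia.
have [cp|pc] := edge_parent epc nepc; first by right; rewrite -cp dcz.
have necr : c != r.
  by apply: contraNneq nepc => cr; rewrite pc cr parent_root.
have [_] := parentP necr; rewrite -pc => dcr.
have sym := dist_sym e_sym e_conn.
case: (IH c dcz) => [|]; last by rewrite -pc dcz dpz; lia.
by rewrite dcr (sym z c) (sym z p) dcz dpz => ->; left; lia.
Qed.

(** By the triangle inequality, each step of a geodesic from z to q approaches the root, so it goes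
    to the parent. *)
Lemma ancestor_iter (z q : T) :
  dist e z r = dist e z q + dist e q r -> q = iter (dist e z q) parent z.
Proof.
move: {2 4}(dist e z q) (erefl (dist e z q)) => n.
elim: n z => [|n IH] z dzq dzr.
  by move/eqP: dzq; rewrite dist_eq0 => /eqP->.
have [w ezw dwq] := dist_succ e_conn dzq.
have nezw : z != w by apply/eqP => zw; move: dzq; rewrite zw dwq; lia.
have le_wr := dist_triangle e_conn q w r.
have le_zr := dist_edge e_conn r ezw.
have [wz|zw] := edge_parent ezw nezw.
  by rewrite iterSr -wz; apply: IH => //; lia.
have newr : w != r.
  by apply: contraNneq nezw => wr; rewrite zw wr parent_root.
by have [_] := parentP newr; rewrite -zw; lia.
Qed.

(** * Gates and the count of covered vertices *)

Variable f : {ffun T -> nat}.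

Definition covers (z v : T) : bool := (0 < f z) && (dist e v z <= f z).

Definition gate (v p : T) : Prop :=
  forall z, covers z v -> dist e v z = dist e v p + dist e p z.

(** The last equation says that p is z or a proper ancestor of z. *)
Definition source (v z : T) : Prop :=
  exists p, [/\ covers z v, gate v p & dist e z r = dist e z p + dist e p r].

(* If a farthest gate of [v] were an ancestor of no [z] covering [v], its parent
   would be a farther gate. *)
Lemma covered_source (v : T) :
  (exists z, covers z v) -> exists z, source v z.
Proof.
move=> [z0 cz0].
have gv : `[< gate v v >] by apply/asboolP => z _; rewrite distxx.
case: (@arg_maxnP _ v (fun p => `[< gate v p >]) (dist e v) gv).
move=> p /asboolP gp max_p.
have [//|no] := pselect (exists z, source v z).
have up z : covers z v -> dist e p z = (dist e (parent p) z).+1.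
  by move=> cz; have [dzr|//] := ancestor_or_up p z; case: no; exists z, p.
have sym := dist_sym e_sym e_conn.
have far : dist e v (parent p) = (dist e v p).+1.
  have := up z0 cz0; have := gp z0 cz0.
  have := dist_triangle e_conn (parent p) v z0.
  (* At the root [up] is absurd, since [parent r = r]. *)
  have [npr|ner] := eqVneq p r; first by rewrite npr parent_root; lia.
  have [epp _] := parentP ner.
  have epp' : e (parent p) p by rewrite e_sym.
  have := dist_edge e_conn v epp'.
  by rewrite (sym _ v) (sym p v); lia.
have /asboolP/max_p : gate v (parent p).
  by move=> z cz; rewrite far gp // up //; lia.
by rewrite /= far; lia.
Qed.

Hypothesis f_res : resolving_broadcast e f.

(** If z covers v, then d(w,z) <= d(w,p) + d(p,z) = d(v,z), so z covers w too and the distances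
    agree. If z covers neither, both are truncated to f z + 1. *)
Lemma gate_inj (v w p : T) :
  gate v p -> gate w p -> dist e v p = dist e w p -> v = w.
Proof.
move=> gv gw dvw; case: (eqVneq v w) => // /f_res[z [fz]]; case.
have tv := dist_triangle e_conn p v z.
have tw := dist_triangle e_conn p w z.
rewrite /dist_trunc; have := gv z; have := gw z; rewrite /covers fz /=.
case: leqP => [_ /(_ erefl) dw|lt_w _];
  case: leqP => [_ /(_ erefl) dv|lt_v _]; lia.
Qed.

Lemma uncovered_inj (v w : T) :
  ~ (exists z, covers z v) -> ~ (exists z, covers z w) -> v = w.
Proof.
move=> nv nw; case: (eqVneq v w) => // /f_res[z [fz]]; case.
have far u : ~ (exists z, covers z u) -> f z < dist e u z.
  move=> nu; rewrite ltnNge; apply/negP => le; case: nu.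
  by exists z; rewrite /covers fz.
by have := far v nv; have := far w nw; rewrite /dist_trunc; lia.
Qed.

Lemma card_source (z : T) (A : {set T}) :
  (forall v, v \in A -> source v z) -> #|A| <= 4 * f z ^ 2.
Proof.
move=> srcA.
have [->|[v0 v0A]] := set_0Vmem A; first by rewrite cards0.
have fz : 0 < f z by have [p [/andP[]]] := srcA v0 v0A.
have le_card : (f z).+1 ^ 2 <= 4 * f z ^ 2 by rewrite !expnS !expn0; nia.
apply: leq_trans le_card.
have /choice[p pP] (v : T) : exists p, v \in A ->
    [/\ covers z v, gate v p & dist e z r = dist e z p + dist e p r].
  by case vA: (v \in A); [have [p] := srcA v vA; exists p | exists v].
(* Both distances are summands of d(v,z) <= f z. *)
have bound v : v \in A -> dist e v (p v) <= f z /\ dist e z (p v) <= f z.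
  move=> /pP[cv gv _]; have := gv z cv; case/andP: cv.
  by rewrite (dist_sym e_sym e_conn z (p v)); lia.
pose code v : 'I_(f z).+1 * 'I_(f z).+1 :=
  (inord (dist e v (p v)), inord (dist e z (p v))).
have code_inj : {in A &, injective code}.
  move=> v w vA wA [/(congr1 (@nat_of_ord _)) + /(congr1 (@nat_of_ord _))].
  have [bv bv'] := bound v vA; have [bw bw'] := bound w wA.
  rewrite !inordK // => dvw dz.
  have [_ gv zv] := pP v vA; have [_ gw zw] := pP w wA.
  (* Both gates are the ancestor of z at the same height above it. *)
  have pvw : p v = p w by rewrite (ancestor_iter zv) (ancestor_iter zw) dz.
  by apply: (gate_inj gv); rewrite ?dvw pvw.
rewrite -(card_in_imset code_inj) (leq_trans (max_card _)) //.
by rewrite card_prod card_ord mulnn.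
Qed.

Lemma card_covered :
  #|[set v | `[< exists z, covers z v >]]| <= 4 * broadcast_cost f ^ 2.
Proof.
set C := [set _ | _].
have /choice[g gP] (v : T) : exists z, v \in C -> source v z.
  case vC: (v \in C); last by exists v.
  by move: vC; rewrite inE => /asboolP/covered_source[z srcz]; exists z.
have -> : #|C| = \sum_z #|[set v in C | g v == z]|.
  rewrite -sum1_card (partition_big g predT) //=; apply: eq_bigr => z _.
  by rewrite -sum1_card; apply: eq_bigl => v; rewrite !inE.
(* One factor of (f z)^2 is bounded by the total cost; the other sums to it. *)
apply: (@leq_trans (\sum_z 4 * (f z * broadcast_cost f))).
  apply: leq_sum => z _; apply: (@leq_trans (4 * f z ^ 2)).
    by apply: card_source => v; rewrite inE => /andP[vC /eqP <-]; apply: gP.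
  rewrite leq_mul2l /= -mulnn leq_mul2l /broadcast_cost.
  by rewrite (bigD1 z) //= leq_addr orbT.
by rewrite -big_distrr -big_distrl /= mulnn.
Qed.

Lemma card_resolving_broadcast : 1 < #|T| -> #|T| <= 6 * broadcast_cost f ^ 2.
Proof.
move=> T_gt1.
(* With b >= 1, the possible uncovered vertex is absorbed: 4 b^2 + 1 <= 6 b^2. *)
have cost_gt0 : 0 < broadcast_cost f.
  have /card_gt1P[x [y [_ _ nexy]]] := T_gt1.
  have [z [fz _]] := f_res nexy.
  by rewrite /broadcast_cost (bigD1 z) //= addn_gt0 fz.
have := card_covered; set C := [set _ | _] => leC.
have : #|~: C| <= 1.
  apply/card_le1_eqP => v w; rewrite !inE => /asboolPn nv /asboolPn nw.
  exact: uncovered_inj.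
rewrite -(cardsC C); move: leC; rewrite !expnS !expn0; nia.
Qed.

End RootedTree.

Unset Implicit Arguments.
Set Strict Implicit.

(* The one-vertex tree is excluded: the zero function resolves it, so its
   broadcast dimension is 0, which is less than sqrt (1/6). *)
Theorem theorem4p3 (R : realType) (T : finType) (e : rel T) (n : nat) :
  tree e -> #|T| = n -> (2 <= n)%N ->
  Num.sqrt (n%:R / 6%:R) <= (bdim e)%:R :> R.
Proof.
move=> [[e_sym _] [T_gt0 e_conn] e_acyclic] <- T_gt1.
have /card_gt0P[r _] := T_gt0.
rewrite /bdim; case: ex_minnP => m /asboolP[f [f_res <-]] _.
have := card_resolving_broadcast e_sym e_conn e_acyclic r f_res T_gt1.
move: (broadcast_cost f) => b le_b.
rewrite -[leRHS]ger0_norm // -sqrtr_sqr ler_wsqrtr // ler_pdivrMr //.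
by rewrite mulrC -natrX -natrM ler_nat.
Qed.
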